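(* Let $\mathscr C$ be a class of graphs and let $a,b>0$ be reals such that $\mathrm{Exp}_{\mathscr C}(r)\le a\,(r+\tfrac12)^b$ for every half-integer $r\ge0$. For an integer $p\ge2$ such that $\frac{\ln 2}{(24\sqrt2\,a)^{1/b}\,b\,p}\le \frac1e$, define \[ g_p=\max\left(7,\;2\left\lfloor-\frac{2b}{\ln 2}\,W_{-1}\!\left(-\frac{\ln 2}{(24\sqrt{2}\,a)^{1/b}\,b\,p}\right)\right\rfloor+4\right)(p-1). \] Then every graph $G\in\mathscr C$ with $\mathrm{girth}(G)>g_p$ is $p$-path degenerate. Moreover $g_p\sim 4bp\log_2 p$ as $p\to\infty$.
   Context: $W_{-1}$ denotes the branch with index $-1$ of the Lambert $W$ function, i.e. for $t\in[-1/e,0)$, $W_{-1}(t)$ is the unique solution $z\le -1$ of $ze^z=t$. Graphs are finite and simple; the girth of a graph is the length of a shortest cycle ($+\infty$ for a forest). A strict ear of a graph $G$ is a path of $G$ whose internal vertices all have degree $2$ in $G$ and whose two endpoints are distinct. For an integer $p\ge1$, a $p$-reduction of $G$ is the deletion of either an isolated vertex, or a vertex of degree $1$, or the internal vertices of a strict ear of $G$ of length at least $p$. A graph is $p$-path degenerate if it can be reduced to the empty graph by a sequence of $p$-reductions. For a half-integer $r\ge0$, a graph $H$ is a shallow minor of $G$ at depth $r$ if to every $v\in V(H)$ one can associate a rooted tree $(T_v,r_v)$ such that the $T_v$ are vertex-disjoint subgraphs of $G$, each $T_v$ has radius at most $\lceil r\rceil$ from its root, and for every edge $uv\in E(H)$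 there is an edge $e$ of $G$ between $T_u$ and $T_v$ such that the path between $r_u$ and $r_v$ in $T_u\cup T_v\cup\{e\}$ has length at most $2r+1$. $\nabla_r(G)$ is the maximum of $|E(H)|/|V(H)|$ over nonempty shallow minors $H$ of $G$ at depth $r$, and $\mathrm{Exp}_{\mathscr C}(r)=\sup\{\nabla_r(G):G\in\mathscr C\}$. *)

(* Defs.v *)
From Stdlib Require Import Reals ClassicalEpsilon.
From Coquelicot Require Import Coquelicot.
From mathcomp Require Import ssreflect ssrbool ssrfun eqtype ssrnat seq path div choice fintype finset.

Set Implicit Arguments.
Unset Strict Implicit.
Unset Printing Implicit Defensive.

Definition sgraph (T : finType) (e : rel T) : Prop := symmetric e /\ irreflexive e.

Definition walk_le (T : finType) (e : rel T) (x y : T) (k : nat) : Prop :=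
  exists s : seq T, [/\ path e x s, last x s = y & (size s <= k)%N].

Definition is_cycle (T : finType) (e : rel T) (c : seq T) : Prop :=
  [/\ (3 <= size c)%N, uniq c & cycle e c].

(** girth(G) > g  (vacuous for forests, whose girth is +oo) *)
Definition girth_gt (T : finType) (e : rel T) (g : R) : Prop :=
  forall c : seq T, is_cycle e c -> (g < INR (size c))%R.

Definition rooted_tree_in (T : finType) (e : rel T) (B : {set T}) (rt : T) (F : rel T) : Prop :=
  [/\ rt \in B, symmetric F,
      (forall x y, F x y -> [&& e x y, x \in B & y \in B]),
      (forall x, x \in B -> exists k, walk_le F rt x k) &
      (forall c, ~ is_cycle F c)].

Definition join_rel (T : finType) (F1 F2 : rel T) (x y : T) : rel T :=
  fun a b => [|| F1 a b, F2 a b, (a == x) && (b == y) | (a == y) && (b == x)].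

(** [H = (U, f)] is a shallow minor of [G = (T, e)] at depth [r = k/2]
    (so ceil r = (k+1)/2 (floor) and 2r+1 = k+1).  In a tree, a walk of
    length <= m between two vertices exists iff the (unique) path between
    them has length <= m. *)
Definition shallow_minor (T : finType) (e : rel T) (U : finType) (f : rel U) (k : nat) : Prop :=
  exists (B : U -> {set T}) (rt : U -> T) (F : U -> rel T),
    [/\ (forall v, rooted_tree_in e (B v) (rt v) (F v)),
        (forall u v, u != v -> [disjoint B u & B v]),
        (forall v x, x \in B v -> walk_le (F v) (rt v) x (k.+1)./2) &
        (forall u v, f u v -> exists x y,
             [&& x \in B u, y \in B v & e x y] /\
             walk_le (join_rel (F u) (F v) x y) (rt u) (rt v) k.+1)].

Definition nedges (U : finType) (f : rel U) : nat := #|[set q : U * U | f q.1 q.2]| %/ 2.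

(** Exp_C(r) <= bound r for all half-integers r = k/2 >= 0, i.e.
    nabla_r(G) <= bound r for all G in C, i.e. every nonempty shallow minor H
    at depth r of every G in C has |E(H)|/|V(H)| <= bound r. *)
Definition Exp_le (C : forall T : finType, rel T -> Prop) (bound : nat -> R) : Prop :=
  forall (T : finType) (e : rel T), sgraph e -> C T e ->
  forall (k : nat) (U : finType) (f : rel U), sgraph f -> (0 < #|U|)%N ->
    shallow_minor e f k ->
    (INR (nedges f) / INR #|U| <= bound k)%R.

Definition deg_in (T : finType) (e : rel T) (S : {set T}) (x : T) : nat :=
  #|[set y in S | e x y]|.

(** one p-reduction of the current graph G[S] (always an induced subgraph of G),
    producing G[S'] *)
Definition p_reduction (T : finType) (e : rel T) (p : nat) (S S' : {set T}) : Prop :=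
  (exists x, [/\ x \in S, (deg_in e S x <= 1)%N & S' = S :\ x]) \/
  (exists (x0 xk : T) (s : seq T),
      [/\ uniq (x0 :: rcons s xk), all (fun v => v \in S) (x0 :: rcons s xk),
          path e x0 (rcons s xk) & x0 != xk] /\
      [/\ (forall v, v \in s -> deg_in e S v = 2%N),
          (p <= (size s).+1)%N
        & S' = S :\: [set v in s]]).

Inductive p_reducible (T : finType) (e : rel T) (p : nat) : {set T} -> Prop :=
  | p_red_empty : p_reducible e p set0
  | p_red_step S S' : p_reduction e p S S' -> p_reducible e p S' -> p_reducible e p S.

Definition p_path_degenerate (T : finType) (e : rel T) (p : nat) : Prop :=
  p_reducible e p [set: T].

(** Lambert W_{-1}: for t in [-1/e, 0), the unique z <= -1 with z e^z = t
    (chosen by Hilbert's epsilon; unspecified outside that range). *)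
Definition LambertWm1 (t : R) : R :=
  epsilon (inhabits 0%R) (fun z : R => (z <= -1)%R /\ (z * exp z = t)%R).

Definition Rfloor (x : R) : R := IZR (Int_part x).

Definition gp_arg (a b : R) (p : nat) : R :=
  (ln 2 / (Rpower (24 * sqrt 2 * a) (/ b) * b * INR p))%R.

Definition gp (a b : R) (p : nat) : R :=
  (Rmax 7 (2 * Rfloor (- (2 * b / ln 2) * LambertWm1 (- gp_arg a b p)) + 4)
    * (INR p - 1))%R.

(* Main.v *)
Require Import Defs.
From Stdlib Require Import Reals ClassicalEpsilon.
From Coquelicot Require Import Coquelicot.
From mathcomp Require Import ssreflect ssrbool ssrfun eqtype ssrnat seq path div choice fintype finset.
From mathcomp Require Import bigop zify.
From Stdlib Require Import Lra Lia.

(** A graph that is not [p]-path degenerate contains a nonempty core [S] in which every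
    degree is at least 2 and every strict ear is shorter than [p]. Give each vertex of the
    core the charge [mu v = deg v - 2]. With [q = p - 1], the girth makes small balls
    trees, and short ears force the charge of a ball to double whenever its radius grows
    by [q]; so every ball of radius [D q] around a branch vertex has charge at least
    [N = 3 * 2 ^ D - 2].

    Choose a set [X] of branch vertices minimising [4 * (charge at distance > D q from X) + N * #|X|].
    Minimality and double counting bound both terms by [4 * (total charge)] and, for the
    first one, even by the total charge. Contract the cells of the Voronoi partition of the
    ball of radius [R = (D + 1) q] around [X]. An edge outside the BFS forest joins two
    different cells and no two such edges join the same pair, since girth exceeds [4 R + 2];
    counting edges by charge, with the loss at the boundary paid by the branch vertices
    between distances [D q] and [R], gives a minor at depth [R] with at least
    [3 * 2 ^ D / 16] edges per vertex. Let [x = - (2 b / ln 2) W], so that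
    [g_p >= (2 floor x + 4) (p - 1)] and [a (y p / 2) ^ b < 2 ^ (y / 2) / (24 sqrt 2)] for
    every [y > x]. With [m = floor x + 1] and [D = floor (m / 2) - 1] the minor violates the
    bound on [Exp]; for [m = 1] the core itself does, as a minor at depth 0. *)

Set Implicit Arguments.
Unset Strict Implicit.
Unset Printing Implicit Defensive.

(** * Short cycles from walks *)

Section Walks.
Variables (T : finType).
Implicit Types (h : rel T) (x y z : T) (k l : nat).

Lemma walk_le_refl h x k : walk_le h x x k.
Proof. by exists [::]. Qed.

Lemma walk_le_mono h h' x y k l : subrel h h' -> (k <= l)%N -> walk_le h x y k -> walk_le h' x y l.
Proof.
move=> hh' kl [s [ps ls ss]]; exists s; split=> //; last exact: leq_trans kl.
exact: sub_path ps.
Qed.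

Lemma walk_le_trans h x y z k l : walk_le h x y k -> walk_le h y z l -> walk_le h x z (k + l).
Proof.
move=> [s [ps ls ss]] [t [pt lt st]]; exists (s ++ t); split.
- by rewrite cat_path ps ls.
- by rewrite last_cat ls.
- by rewrite size_cat leq_add.
Qed.

Lemma walk_le_edge h x y : h x y -> walk_le h x y 1.
Proof. by move=> hxy; exists [:: y]; rewrite /= hxy. Qed.

Lemma walk_le_sym h x y k : symmetric h -> walk_le h x y k -> walk_le h y x k.
Proof.
move=> sh [s [ps ls ss]]; exists (rev (belast x s)); split.
- rewrite -ls rev_path; apply: sub_path ps => a b; by rewrite sh.
- by case: s {ps ss} ls => [|a s] //= ls; rewrite rev_cons last_rcons.
- by rewrite size_rev size_belast.
Qed.

Definition del_edge h x y : rel T :=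
  fun a b => h a b && ~~ ((a == x) && (b == y) || (a == y) && (b == x)).

(** Shortening the walk to a simple path and adding the edge [x y] closes a cycle. The path has at
    least two steps: [x] differs from [y] by irreflexivity, and the one-step path is the deleted
    edge. *)
Lemma cycle_through_edge h x y k : symmetric h -> irreflexive h -> h x y ->
  walk_le (del_edge h x y) x y k -> exists2 c, is_cycle h c & (size c <= k.+1)%N.
Proof.
move=> sh ih hxy [s [ps ls ss]].
case: (shortenP ps) ls => s' ps' us' sub ls'.
have zs : (size s' <= k)%N.
  by apply: leq_trans ss; apply: uniq_leq_size; case/andP: us'.
have ps'' : path h x s' by apply: sub_path ps' => a b /andP[].
exists (x :: s') => //; split=> //.
- case: s' ps' ls' {us' sub zs ps''} => [|a [|b s']] //=.
    by move=> _ xy; move: hxy; rewrite -xy ih.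
  by rewrite /del_edge => /andP[/andP[_ +] _] ay; rewrite ay !eqxx.
- by rewrite /= rcons_path ps'' ls' sh.
Qed.

End Walks.

(** * Breadth-first forests *)

Section Forest.
Variables (T : finType) (h : rel T).
Hypotheses (sh : symmetric h) (ih : irreflexive h).
Implicit Types (x y z : T) (X : {set T}).

Definition deg x := #|[set y | h x y]|.
(** The subtraction is truncated: outside the core the degree is 0 and so is the charge. *)
Definition mu x := (deg x - 2)%N.
Definition muS (A : {set T}) := (\sum_(x in A) mu x)%N.

Fixpoint nbhd X r : {set T} :=
  if r is r'.+1 then nbhd X r' :|: [set y | [exists x in nbhd X r', h x y]] else X.

Lemma nbhdP X r y : reflect (exists2 v, v \in X & walk_le h v y r) (y \in nbhd X r).
Proof.
apply: (iffP idP).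
  elim: r y => [|r IH] y /=; first by exists y => //; apply: walk_le_refl.
  rewrite !inE => /orP[/IH[v vX w]|/existsP[x /andP[/IH[v vX w] hxy]]]; exists v => //.
    by apply: walk_le_mono (leqnSn _) w.
  by rewrite -addn1; apply: walk_le_trans w (walk_le_edge hxy).
case=> v vX [s [+ + +]]; elim/last_ind: s r y => [|s z IH] r y.
  move=> _ <- _; elim: r => //= r IH; by rewrite !inE IH.
rewrite rcons_path last_rcons size_rcons => /andP[ps hz] <-; case: r => // r sr /=.
by rewrite !inE; apply/orP; right; apply/existsP; exists (last v s); rewrite hz (IH r) .
Qed.

Lemma nbhd_mono X r s : (r <= s)%N -> nbhd X r \subset nbhd X s.
Proof.
move=> rs; apply/subsetP => x /nbhdP[v vX w]; apply/nbhdP; exists v => //.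
exact: walk_le_mono rs w.
Qed.

Lemma nbhd1_sym x y r : (x \in nbhd [set y] r) = (y \in nbhd [set x] r).
Proof.
by apply/nbhdP/nbhdP => -[v /set1P-> w]; [exists x|exists y]; rewrite ?set11 //; apply: walk_le_sym.
Qed.

Lemma nbhdU1 v X r : nbhd (v |: X) r = nbhd [set v] r :|: nbhd X r.
Proof.
apply/setP => x; rewrite inE; apply/nbhdP/orP.
  case=> u /setU1P[->|uX] w; [left|right]; apply/nbhdP; first by exists v; rewrite ?set11.
  by exists u.
by case=> /nbhdP[u uX w]; exists u => //; move: uX; rewrite !inE => ->; rewrite ?orbT.
Qed.

Variables (X : {set T}) (K : nat).
Hypothesis K0 : (0 < K)%N.

(* Distance to [X], capped at [K]: [dist x = K] means "farther than [K - 1] or unreachable". *)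
Definition dist x := find (fun r => x \in nbhd X r) (iota 0 K).

Lemma dist_le_nbhd x r : (r < K)%N -> (dist x <= r)%N = (x \in nbhd X r).
Proof.
move=> rK; apply/idP/idP => [dr|xr].
  have dK : (dist x < K)%N by apply: leq_ltn_trans rK.
  have H : has (fun r => x \in nbhd X r) (iota 0 K) by rewrite has_find size_iota.
  have := nth_find 0%N H; rewrite -/(dist x) nth_iota // add0n.
  exact: (subsetP (nbhd_mono _ dr)).
rewrite leqNgt; apply/negP => /(before_find 0%N).
by rewrite nth_iota // add0n xr.
Qed.

Lemma dist_max x : (dist x <= K)%N.
Proof. by rewrite -[leqRHS](size_iota 0) find_size. Qed.

Lemma dist0 x : (dist x == 0)%N = (x \in X).
Proof. by rewrite -leqn0 dist_le_nbhd. Qed.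

Lemma dist_edge x y : h x y -> (dist y <= (dist x).+1)%N.
Proof.
move=> hxy; case: (ltnP (dist x).+1 K) => [lt|ge]; last exact: leq_trans (dist_max y) ge.
rewrite dist_le_nbhd // !inE; apply/orP; right; apply/existsP; exists x.
by rewrite hxy -dist_le_nbhd ?leqnn // ltnW.
Qed.

(** The default [x] never occurs when [0 < dist x < K], by [parP]. *)
Definition par x := odflt x [pick y | h x y && (dist x == (dist y).+1)].

Lemma parP x : (0 < dist x < K)%N -> h x (par x) /\ dist x = (dist (par x)).+1.
Proof.
case/andP=> d0 dK; rewrite /par; case: pickP => [y /andP[hxy /eqP]//|none].
case E: (dist x) d0 dK => [//|s] _ sK.
have : x \in nbhd X s.+1 by rewrite -dist_le_nbhd // E.
rewrite !inE -dist_le_nbhd ?E ?ltnn /=; last exact: ltnW.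
case/existsP=> y /andP[ys hyx].
have dy : (dist y <= s)%N by rewrite dist_le_nbhd // ltnW.
have := none y; rewrite sh hyx /= E eqn_leq !ltnS dy.
by rewrite -ltnS -E dist_edge.
Qed.

Lemma par_adj x : (0 < dist x < K)%N -> h x (par x).
Proof. by case/parP. Qed.
Lemma dist_par x : (0 < dist x < K)%N -> dist x = (dist (par x)).+1.
Proof. by case/parP. Qed.

Lemma dist_iter_par x i : (i <= dist x < K)%N -> dist (iter i par x) = (dist x - i)%N.
Proof.
elim: i => [|i IH] /andP[ix xK]; first by rewrite subn0.
have E : dist (iter i par x) = (dist x - i)%N by apply: IH; rewrite xK ltnW.
have H : (0 < dist (iter i par x) < K)%N by rewrite E; lia.
by have := dist_par H; rewrite E iterS; lia.
Qed.

Definition rt x := iter (dist x) par x.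

Lemma dist_rt x : (dist x < K)%N -> dist (rt x) = 0%N.
Proof. by move=> dK; rewrite dist_iter_par ?leqnn // subnn. Qed.

Lemma rt_in x : (dist x < K)%N -> rt x \in X.
Proof. by move=> dK; rewrite -dist0 dist_rt. Qed.

Lemma rt_id x : x \in X -> rt x = x.
Proof. by rewrite -dist0 /rt => /eqP->. Qed.

Lemma rt_par x : (0 < dist x < K)%N -> rt (par x) = rt x.
Proof. by move=> dx; rewrite /rt [in RHS](dist_par dx) iterSr. Qed.

Definition tree x y :=
  [&& (0 < dist x < K)%N & par x == y] || [&& (0 < dist y < K)%N & par y == x].

Lemma tree_sym : symmetric tree.
Proof. by move=> x y; rewrite /tree orbC. Qed.

Lemma tree_sub : subrel tree h.
Proof.
by move=> x y /orP[] /andP[d /eqP<-]; rewrite ?par_adj // sh par_adj.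
Qed.

(** Ties between equally near vertices of [X] are settled by the choice of [par]; parent chains stay
    in one cell, so the cells are disjoint and connected. *)
Definition cell v : {set T} := [set x | (dist x < K)%N && (rt x == v)].
Definition cell_tree v : rel T := fun x y => [&& tree x y, x \in cell v & y \in cell v].

Lemma cell_tree_sym v : symmetric (cell_tree v).
Proof. by move=> x y; rewrite /cell_tree tree_sym (andbC (x \in _)). Qed.

Lemma walk_root x : (dist x < K)%N -> walk_le (cell_tree (rt x)) (rt x) x (dist x).
Proof.
move Ed: (dist x) => n; elim: n x Ed => [|n IH] x dx dK.
  by rewrite /rt dx; apply: walk_le_refl.
have H : (0 < dist x < K)%N by rewrite dx dK.
have E : dist (par x) = n by have := dist_par H; rewrite dx => -[].
have := IH _ E (ltnW dK); rewrite (rt_par H) -addn1 => w.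
apply: (walk_le_trans w); apply: walk_le_edge.
by rewrite /cell_tree /tree H eqxx orbT !inE rt_par // eqxx dx dK E ltnW.
Qed.

Variable g : nat.
Hypothesis girth : forall c, is_cycle h c -> (g < size c)%N.

(** A non-tree edge and the parent chains of its ends to their common root would contain a cycle of
    length at most [dist x + dist y + 1]. *)
Lemma short_edge_tree x y : h x y -> (dist x < K)%N -> (dist y < K)%N -> rt x = rt y ->
  (dist x + dist y < g)%N -> tree x y.
Proof.
move=> hxy dx dy rxy lt; apply/negPn/negP => nt.
have sub v : subrel (cell_tree v) (del_edge h x y).
  move=> a b /andP[tab _]; rewrite /del_edge tree_sub //=; apply/negP => /orP[] /andP[/eqP aE /eqP bE].
    by rewrite -aE -bE tab in nt.
  by rewrite -aE -bE tree_sym tab in nt.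
have w1 := walk_le_sym (cell_tree_sym _) (walk_root dx).
have w2 := walk_root dy; rewrite -rxy in w2.
have := walk_le_trans w1 w2.
move/(walk_le_mono (sub _) (leqnn _)) /(cycle_through_edge sh ih hxy) => [c cc].
by move=> sc; have := girth cc; lia.
Qed.

(** Two such edges, joined inside the two cells by four parent chains of length at most [R], would
    give a cycle of length at most [4 * R + 2]. *)
Lemma cell_edge_unique R x1 y1 x2 y2 : (4 * R + 2 <= g)%N -> (K <= R.+1)%N ->
  h x1 y1 -> h x2 y2 ->
  (dist x1 < K)%N -> (dist y1 < K)%N -> (dist x2 < K)%N -> (dist y2 < K)%N ->
  rt x1 = rt x2 -> rt y1 = rt y2 -> rt x1 != rt y1 -> (x1, y1) = (x2, y2).
Proof.
move=> gR KR h1 h2 dx1 dy1 dx2 dy2 rx ry rxy; apply/eqP/negPn/negP => ne.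
have sub v : subrel (cell_tree v) (del_edge h x1 y1).
  move=> a b /and3P[tab]; rewrite !inE => /andP[_ /eqP ra] /andP[_ /eqP rb].
  rewrite /del_edge tree_sub //=; apply/negP => /orP[] /andP[/eqP aE /eqP bE];
  by move: rxy; rewrite -aE -bE ra rb eqxx.
have w1 := walk_le_sym (cell_tree_sym _) (walk_root dx1).
have w2 := walk_root dx2; rewrite -rx in w2.
have w3 : walk_le (del_edge h x1 y1) x2 y2 1.
  apply: walk_le_edge; rewrite /del_edge h2 /=; apply/negP => /orP[] /andP[/eqP aE /eqP bE].
    by rewrite aE bE eqxx in ne.
  by move: rxy; rewrite rx aE eqxx.
have w4 := walk_le_sym (cell_tree_sym _) (walk_root dy2).
have w5 := walk_root dy1; rewrite ry in w5.
have w := walk_le_trans (walk_le_trans (walk_le_mono (sub _) (leqnn _) w1)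
  (walk_le_mono (sub _) (leqnn _) w2)) w3.
have w' := walk_le_trans (walk_le_trans w (walk_le_mono (sub _) (leqnn _) w4))
  (walk_le_mono (sub _) (leqnn _) w5).
have [c cc sc] := cycle_through_edge sh ih h1 w'.
have := girth cc; lia.
Qed.


(** * Counting darts at covered vertices *)

Lemma card_pairs (Q : rel T) : #|[set q : T * T | Q q.1 q.2]| = (\sum_x #|[set y | Q x y]|)%N.
Proof.
under eq_bigr => x _ do rewrite -sum1_card.
rewrite (pair_big_dep predT (fun x y => y \in [set y | Q x y])) /= -sum1_card.
by apply: eq_bigl => -[x y]; rewrite !inE.
Qed.

Definition covered : {set T} := [set x | (dist x < K)%N].
Definition out_darts : {set T * T} := [set q | h q.1 q.2 && ((q.1 \in covered) && (q.2 \notin covered))].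
Definition tree_darts : {set T * T} := [set q | tree q.1 q.2].
Definition cross_darts : {set T * T} :=
  [set q | [&& h q.1 q.2, q.1 \in covered, q.2 \in covered & rt q.1 != rt q.2]].

Lemma sub_covered : X \subset covered.
Proof. by apply/subsetP => x; rewrite -dist0 inE => /eqP->. Qed.

Lemma card_tree_darts : (#|tree_darts| + 2 * #|X| <= 2 * #|covered|)%N.
Proof.
have E : #|covered :\: X| = (#|covered| - #|X|)%N by rewrite cardsD (setIidPr sub_covered).
have le := subset_leq_card sub_covered.
suff : (#|tree_darts| <= 2 * #|covered :\: X|)%N by rewrite E; lia.
have : tree_darts \subset [set (x, par x) | x in covered :\: X] :|: [set (par x, x) | x in covered :\: X].
  apply/subsetP => -[x y]; rewrite !inE /= => /orP[] /andP[/andP[d0 dK] /eqP E'].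
    by apply/orP; left; apply/imsetP; exists x; rewrite ?E' // !inE dK -dist0 -lt0n d0.
  by apply/orP; right; apply/imsetP; exists y; rewrite ?E' // !inE dK -dist0 -lt0n d0.
move/subset_leq_card; move/leq_trans; apply.
apply: leq_trans (leq_card_setU _ _) _; rewrite mul2n -addnn.
by apply: leq_add; apply: leq_imset_card.
Qed.

Lemma sum_deg_covered :
  {in covered, forall x, (2 <= deg x)%N} ->
  (\sum_(x in covered) deg x = muS covered + 2 * #|covered|)%N.
Proof.
move=> d2; rewrite /muS -sum1_card big_distrr -big_split /=; apply: eq_bigr => x /d2.
rewrite /mu; lia.
Qed.

(** Every dart from a covered vertex leaves the covered set, changes cell, or is a tree dart. The
    degree sum is the charge plus [2 * #|covered|], and tree darts use at most
    [2 * #|covered| - 2 * #|X|] of it. *)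
Lemma card_cross_darts : (forall x y, x \in covered -> y \in covered -> (dist x + dist y < g)%N) ->
  {in covered, forall x, (2 <= deg x)%N} ->
  (muS covered + 2 * #|X| <= #|cross_darts| + #|out_darts|)%N.
Proof.
move=> lt d2.
have E : (\sum_(x in covered) deg x = #|[set q : T * T | h q.1 q.2 && (q.1 \in covered)]|)%N.
  rewrite (card_pairs (fun x y => h x y && (x \in covered))) big_mkcond /=; apply: eq_bigr => x _.
  case: ifP => xc; first by apply: eq_card => y; rewrite !inE andbT.
  by rewrite (_ : [set _ | _] = set0) ?cards0 //; apply/setP => y; rewrite !inE andbF.
have S : [set q : T * T | h q.1 q.2 && (q.1 \in covered)] \subset cross_darts :|: out_darts :|: tree_darts.
  apply/subsetP => -[x y]; rewrite !inE /= => /andP[hxy xc]; rewrite hxy xc /=.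
  case yc : (dist y < K)%N; rewrite ?orbT //= orbF.
  case: eqP => //= rxy; rewrite short_edge_tree ?lt ?inE //.
have le : (\sum_(x in covered) deg x <= #|cross_darts| + #|out_darts| + #|tree_darts|)%N.
  rewrite E (leq_trans (subset_leq_card S)) // (leq_trans (leq_card_setU _ _)) //.
  by rewrite leq_add2r leq_card_setU.
rewrite sum_deg_covered // in le.
by have := card_tree_darts; lia.
Qed.

(** * The minor obtained by contracting the cells *)

Definition centers := {x : T | x \in X}.
Definition cell_adj : rel centers :=
  fun u v => (u != v) && [exists x in cell (val u), exists y in cell (val v), h x y].

Lemma cell_adj_sgraph : sgraph cell_adj.
Proof.
split=> [u v|u]; last by rewrite /cell_adj eqxx.
rewrite /cell_adj eq_sym; congr (_ && _).
by apply/idP/idP => /existsP[x /andP[xu /existsP[y /andP[yv hxy]]]]; apply/existsP; exists y;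
  rewrite yv; apply/existsP; exists x; rewrite xu sh.
Qed.

Lemma card_cell_adj R : (4 * R + 2 <= g)%N -> (K <= R.+1)%N ->
  (#|cross_darts| <= #|[set q : centers * centers | cell_adj q.1 q.2]|)%N.
Proof.
move=> gR KR.
have inj : {in cross_darts &, injective (fun q : T * T => (rt q.1, rt q.2))}.
  move=> [x1 y1] [x2 y2]; rewrite !inE /= => /and4P[h1 dx1 dy1 r1] /and4P[h2 dx2 dy2 _] [rx ry].
  exact: (cell_edge_unique gR KR h1 h2).
rewrite -(card_in_imset inj).
rewrite -(card_imset _ (f := fun q : centers * centers => (val q.1, val q.2))); last first.
  by move=> [a b] [c d] [] /= /val_inj-> /val_inj->.
apply: subset_leq_card; apply/subsetP => _ /imsetP[[x y] + ->] /=.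
rewrite !inE /= => /and4P[hxy dx dy rxy].
apply/imsetP; exists (exist _ (rt x) (rt_in dx), exist _ (rt y) (rt_in dy)) => //.
rewrite inE /cell_adj -val_eqE /= rxy; apply/existsP; exists x; rewrite inE dx eqxx /=.
by apply/existsP; exists y; rewrite inE dy eqxx.
Qed.

Lemma tree_par x y : tree x y -> (dist x <= dist y)%N -> par y = x.
Proof.
case/orP=> /andP[d /eqP E] //; have := dist_par d; rewrite E; lia.
Qed.

(* At a vertex of maximal distance, both neighbours on the cycle would be its parent. *)
Lemma cell_tree_acyclic v c : ~ is_cycle (cell_tree v) c.
Proof.
case=> s3 uc cc.
have [x0 x0c] : exists x, x \in c by case: c s3 {uc cc} => // a c _; exists a; rewrite inE eqxx.
have [x xc xmax] : exists2 x, x \in c & forall y, y \in c -> (dist y <= dist x)%N.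
  case: (@arg_maxnP T x0 (fun x => x \in c) dist x0c) => x xc H; by exists x.
case: (rot_to xc) => i c' Ec.
have : uniq (x :: c') by rewrite -Ec rot_uniq.
have : (3 <= size (x :: c'))%N by rewrite -Ec size_rot.
have xmax' y : y \in x :: c' -> (dist y <= dist x)%N by rewrite -Ec mem_rot; apply: xmax.
have : cycle (cell_tree v) (x :: c') by rewrite -Ec rot_cycle.
case: c' {Ec} xmax' => [|a c'] xmax' //; case/lastP: c' xmax' => [|c' b] //= xmax'.
rewrite rcons_path last_rcons => /andP[/andP[xa _]] /andP[_ /andP[bx _]] _.
have -> : a = b.
  transitivity (par x); first by symmetry; apply: tree_par; rewrite 1?tree_sym // xmax' // !inE eqxx orbT.
  by apply: tree_par; rewrite // xmax' // !inE mem_rcons inE eqxx !orbT.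
by rewrite mem_rcons inE eqxx /= andbF.
Qed.

(** The cells have radius at most [R], so two adjacent roots are joined by a walk of length at most
    [R + 1 + R]; the index [2 * R] encodes depth [R]. *)
Lemma shallow_minor_cells (e : rel T) R : K = R.+1 -> subrel h e -> shallow_minor e cell_adj (2 * R).
Proof.
move=> KR he; exists (fun v => cell (val v)), (fun v => val v), (fun v => cell_tree (val v)); split.
- move=> v; split.
  + by rewrite inE rt_id ?(valP v) // eqxx (eqP (_ : dist (val v) == 0)%N) ?K0 // dist0 (valP v).
  + exact: cell_tree_sym.
  + by move=> x y /and3P[/tree_sub/he -> -> ->].
  + move=> x; rewrite inE => /andP[dx /eqP <-]; exists (dist x); exact: walk_root.
  + by move=> c; apply: cell_tree_acyclic.
- move=> u v uv; rewrite -setI_eq0; apply/eqP/setP => x; rewrite !inE.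
  by apply: contraNF uv => /andP[/andP[_ /eqP Eu] /andP[_ /eqP Ev]]; rewrite -val_eqE /= -Eu Ev.
- move=> v x; rewrite inE => /andP[dx /eqP <-].
  by apply: walk_le_mono (walk_root dx) => //; rewrite KR in dx; lia.
- move=> u v /andP[_ /existsP[x /andP[xu /existsP[y /andP[yv hxy]]]]]; exists x, y; split.
    by rewrite xu yv he.
  move: xu yv; rewrite !inE => /andP[dx /eqP <-] /andP[dy /eqP <-].
  have w1 : walk_le (join_rel (cell_tree (rt x)) (cell_tree (rt y)) x y) (rt x) x (dist x).
    by apply: walk_le_mono (walk_root dx) => // a b ab; rewrite /join_rel ab.
  have w2 : walk_le (join_rel (cell_tree (rt x)) (cell_tree (rt y)) x y) y (rt y) (dist y).
    apply: walk_le_mono (walk_le_sym (@cell_tree_sym _) (walk_root dy)) => // a b ab.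
    by rewrite /join_rel ab orbT.
  have w3 : walk_le (join_rel (cell_tree (rt x)) (cell_tree (rt y)) x y) x y 1.
    by apply: walk_le_edge; rewrite /join_rel !eqxx !orbT.
  apply: walk_le_mono (walk_le_trans (walk_le_trans w1 w3) w2) => //.
  rewrite KR in dx dy; lia.
Qed.


(** * Consequences of short ears *)

Variable q : nat.
Hypothesis deg2 : forall x y, h x y -> (2 <= deg x)%N.
Hypothesis short_ears : forall u z s, uniq (u :: rcons s z) -> path h u (rcons s z) ->
  (forall v, v \in s -> deg v = 2%N) -> (size s < q)%N.

(** The decreasing distance is carried along because it makes the chain free of repetitions in
    [branch_on_chain]. *)
Lemma path_traject_par n u c : h u c -> (dist c < dist u)%N -> (n <= dist c < K)%N ->
  path (fun x y => h x y && (dist y < dist x)%N) u (traject par c n.+1).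
Proof.
elim: n u c => [|n IH] u c huc du /andP[nc cK]; first by rewrite /= huc du.
have H : (0 < dist c < K)%N by rewrite cK; lia.
have E := dist_par H.
by rewrite trajectS /= huc du; apply: IH; [exact: par_adj|lia|lia].
Qed.

(* Otherwise [u] followed by the parent chain of [c] would be a strict ear of length [q + 1]. *)
Lemma branch_on_chain c u : h c u -> (dist c < K)%N -> dist u = (dist c).+1 -> (q <= dist c)%N ->
  exists2 i, (i < q)%N & (0 < mu (iter i par c))%N.
Proof.
move=> hcu cK du qc.
case: (boolP [exists i : 'I_q, 0 < mu (iter i par c)]%N) => [/existsP[i Hi]|]; first by exists i.
rewrite negb_exists => /forallP no; exfalso.
have huc : h u c by rewrite sh.
have P : path (fun x y => h x y && (dist y < dist x)%N) u (traject par c q.+1).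
  by apply: path_traject_par; rewrite ?du ?qc ?cK.
rewrite trajectSr in P.
have : (size (traject par c q) < q)%N; last by rewrite size_traject ltnn.
apply: (short_ears (u := u) (z := iter q par c)).
- apply: (@sorted_uniq _ (fun x y => dist y < dist x)%N).
  + by move=> x y z; lia.
  + by move=> x; rewrite ltnn.
  + by apply: sub_path P => x y /andP[].
- by apply: sub_path P => x y /andP[].
- move=> v /trajectP[i iq ->].
  have D : (0 < dist (iter i par c) < K)%N by rewrite dist_iter_par; lia.
  have := no (Ordinal iq); rewrite /= -leqNgt /mu; have := deg2 (par_adj D); lia.
Qed.

Definition children w := [set u | h w u && (dist u == (dist w).+1)].

(** One of the [mu w + 2] neighbours is the parent. *)
Lemma card_children w : (0 < dist w < K)%N -> (#|children w| <= 1 + mu w)%N.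
Proof.
move=> dw; have := par_adj dw; have E := dist_par dw => hw.
have S : children w \subset [set y | h w y] :\ par w.
  by apply/subsetP => u; rewrite !inE => /andP[-> /eqP du]; rewrite andbT; apply/eqP => H; rewrite H in du; lia.
have := subset_leq_card S; have := cardsD1 (par w) [set y | h w y]; rewrite inE hw.
by rewrite -/(deg w) /mu; have := deg2 hw; lia.
Qed.

(** * Darts leaving the covered set *)

Section OutDarts.
Variable r0 : nat.

(* Vertices at distance [r0 + j] whose parent chain meets a branch vertex beyond distance [r0]. *)
Definition below_branch j :=
  [set y | (dist y == r0 + j)%N && [exists i : 'I_j, 0 < mu (iter i par y)]%N].

(** If [y] is not a branch vertex itself, the branch vertex on its chain lies on the chain of its
    parent. *)
Lemma below_branchS j : (r0 + j.+1 < K)%N ->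
  below_branch j.+1 \subset [set y | (dist y == r0 + j.+1)%N && (0 < mu y)%N]
                              :|: \bigcup_(w in below_branch j) children w.
Proof.
move=> jK; apply/subsetP => y; rewrite !inE => /andP[dy /existsP[[i ij] /= Hi]].
rewrite dy; case: (ltnP 0 (mu y)) => //= m0.
case: i ij Hi => [|i] ij Hi; first by rewrite /= in Hi; lia.
have D : (0 < dist y < K)%N by rewrite (eqP dy); lia.
have E := dist_par D.
apply/bigcupP; exists (par y); rewrite !inE.
  apply/andP; split; first by have := eqP dy; lia.
  by apply/existsP; exists (Ordinal (ij : (i < j)%N)); rewrite /= -iterSr.
by rewrite sh par_adj // E eqxx.
Qed.

Lemma card_bigcup_leq (A : {set T}) (F : T -> {set T}) :
  (#|\bigcup_(w in A) F w| <= \sum_(w in A) #|F w|)%N.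
Proof.
elim/big_rec2: _ => [|w n B _ le]; first by rewrite cards0.
by rewrite (leq_trans (leq_card_setU _ _)) // leq_add2l.
Qed.

Lemma sum_children_below_branch j : (r0 + j < K)%N ->
  (\sum_(w in below_branch j) #|children w| <=
   #|below_branch j| + \sum_(y | dist y == r0 + j) mu y)%N.
Proof.
move=> jK.
apply: (@leq_trans (\sum_(w in below_branch j) (1 + mu w))%N).
  apply: leq_sum => w; rewrite inE => /andP[/eqP dw /existsP[[i ij] _]].
  by apply: card_children; rewrite dw; lia.
rewrite big_split /= sum1_card leq_add2l.
rewrite [leqRHS](bigID (fun y => y \in below_branch j)) /=.
rewrite (eq_bigl (fun y => (dist y == r0 + j)%N && (y \in below_branch j))) ?leq_addr //.
by move=> y; rewrite inE andbA andbb.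
Qed.

Lemma below_branch0 : below_branch 0 = set0.
Proof. by apply/setP => y; rewrite !inE; apply/negbTE/negP => /andP[_ /existsP[[]]]. Qed.

Lemma card_below_branchS j : (r0 + j.+1 < K)%N ->
  (#|below_branch j.+1| <= \sum_(y | dist y == r0 + j.+1) mu y + \sum_(w in below_branch j) #|children w|)%N.
Proof.
move=> jK; apply: (leq_trans (subset_leq_card (below_branchS jK))).
apply: (leq_trans (leq_card_setU _ _)); apply: leq_add; last exact: card_bigcup_leq.
rewrite -sum1_card big_mkcond [leqRHS]big_mkcond /=; apply: leq_sum => y _.
by rewrite inE; case: eqP => //=; case: (mu y).
Qed.

(** A level's charge is paid at most twice: once for its own branch vertices and once for the extra
    children they produce. The second summand on the left reserves the latter payment for the next
    level. *)
Lemma card_below_branch j : (r0 + j.+1 < K)%N ->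
  (#|below_branch j.+1| + \sum_(y | dist y == r0 + j.+1) mu y
     <= 2 * \sum_(y | r0 < dist y <= r0 + j.+1) mu y)%N.
Proof.
have E k : (\sum_(y | r0 < dist y <= r0 + k.+1) mu y = \sum_(y | r0 < dist y <= r0 + k) mu y
             + \sum_(y | dist y == r0 + k.+1) mu y)%N.
  rewrite (bigID (fun y => dist y <= r0 + k)%N) /=; congr (_ + _)%N; apply: eq_bigl => y; lia.
elim: j => [|j IH] jK; have le := card_below_branchS jK; rewrite E.
  rewrite below_branch0 big_set0 in le; lia.
have := @sum_children_below_branch j.+1 ltac:(lia); have := IH ltac:(lia); lia.
Qed.

(** Such a dart goes from distance exactly [r0 + q] to a child, and short ears put a branch vertex
    among the last [q] vertices of its tail's chain, so the tail is in [below_branch q]. *)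
Lemma card_out_darts : (0 < q)%N -> K = (r0 + q).+1 ->
  (#|out_darts| <= 2 * \sum_(y | r0 < dist y < K) mu y)%N.
Proof.
move=> q0 KE.
have qK : (r0 + q < K)%N by rewrite KE.
have qE : q = q.-1.+1 by rewrite prednK.
have := @card_below_branch q.-1; rewrite -qE => /(_ qK).
rewrite (@eq_bigl _ _ _ _ _ (fun y => r0 < dist y <= r0 + q)%N (fun y => r0 < dist y < K)%N); last by move=> y; lia.
apply: leq_trans; apply: leq_trans (sum_children_below_branch qK).
rewrite (card_pairs (fun c u => h c u && ((c \in covered) && (u \notin covered)))).
rewrite [leqRHS]big_mkcond /=; apply: leq_sum => c _; rewrite -sum1_card.
have H u : u \in [set u | h c u && ((c \in covered) && (u \notin covered))] ->
    (c \in below_branch q) && (u \in children c).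
  rewrite !inE => /and3P[hcu cK uK].
  have E := dist_edge hcu; have M := dist_max u.
  have dc : dist c = (r0 + q)%N by lia.
  have du : dist u = (dist c).+1 by lia.
  have [i iq mi] := branch_on_chain hcu cK du ltac:(lia).
  rewrite dc eqxx hcu du dc eqxx /= andbT.
  by apply/existsP; exists (Ordinal iq).
case: ifP => cb; last by rewrite big_pred0 // => u; apply/negP => /H; rewrite cb.
by rewrite sum1_card; apply: subset_leq_card; apply/subsetP => u /H /andP[].
Qed.

End OutDarts.


(** * Growth of charge in balls around one vertex *)

Section Growth.
Variable v : T.
Hypotheses (Xv : X = [set v]) (vdeg : (2 <= deg v)%N) (acyc : (2 * K <= g.+1)%N).

Lemma rt_single x : (dist x < K)%N -> rt x = v.
Proof. by move=> /rt_in; rewrite Xv => /set1P. Qed.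

Lemma dist_root : dist v = 0%N.
Proof. by apply/eqP; rewrite dist0 Xv set11. Qed.

(** There is a single root and [2 * K <= g + 1], so every edge between vertices at distance below
    [K] is a tree edge. *)
Lemma nbr_child w y : ((dist w).+1 < K)%N -> h w y -> ((0 < dist w)%N -> y != par w) ->
  par y = w /\ dist y = (dist w).+1.
Proof.
move=> wK hwy yn; have dy := dist_edge hwy.
have : tree w y by apply: short_edge_tree; rewrite ?rt_single //; lia.
case/orP => /andP[d /eqP E]; last by split=> //; rewrite -E dist_par.
by case/andP: d => /yn; rewrite E eqxx.
Qed.

Definition layer s : {set T} := [set x | dist x == s].

Lemma card_layerS s : (0 < s)%N -> (s.+1 < K)%N ->
  (#|layer s| + \sum_(w in layer s) mu w <= #|layer s.+1|)%N.
Proof.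
move=> s0 sK.
have parL u : u \in layer s.+1 -> par u \in layer s.
  by rewrite !inE => /eqP du; have := @dist_par u; rewrite du => /(_ sK) [<-].
have -> : (#|layer s| + \sum_(w in layer s) mu w = \sum_(w in layer s) (1 + mu w))%N.
  by rewrite big_split /= sum1_card.
rewrite -sum1_card [leqRHS](partition_big par (fun w => w \in layer s)) //=.
apply: leq_sum => w; rewrite inE => /eqP dw.
have D : (0 < dist w < K)%N by rewrite dw s0 ltnW.
have hw := par_adj D.
rewrite sum1dep_card.
have S : [set y | h w y] :\ par w \subset [set u | (u \in layer s.+1) && (par u == w)].
  apply/subsetP => y; rewrite !inE => /andP[yp hwy].
  by case: (@nbr_child w y); rewrite ?dw // => -> ->; rewrite !eqxx.
have := subset_leq_card S; have := cardsD1 (par w) [set y | h w y]; rewrite inE hw.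
rewrite -/(deg w) /mu; have := deg2 hw; lia.
Qed.

Lemma card_layer1 : (1 < K)%N -> (2 + mu v <= #|layer 1|)%N.
Proof.
move=> K1; have -> : (2 + mu v = deg v)%N by rewrite /mu; lia.
apply: subset_leq_card; apply/subsetP => y; rewrite !inE => hvy.
by case: (@nbr_child v y); rewrite ?dist_root // => _ ->.
Qed.

Definition mu_ball r := (\sum_(x | dist x <= r) mu x)%N.

Lemma mu_ballD r s : mu_ball (r + s) = (mu_ball r + \sum_(x | r < dist x <= r + s) mu x)%N.
Proof.
rewrite /mu_ball (bigID (fun x => dist x <= r)%N) /=.
by congr (_ + _)%N; apply: eq_bigl => x; lia.
Qed.

(** The first layer has at least [2 + mu v] vertices and each later one exceeds its predecessor by
    at least the predecessor's charge; the sum telescopes. *)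
Lemma card_layer_ball s : (s.+1 < K)%N -> (2 + mu_ball s <= #|layer s.+1|)%N.
Proof.
elim: s => [|s IH] sK.
  rewrite /mu_ball (big_pred1 v) ?card_layer1 // => x.
  by rewrite leqn0 dist0 Xv inE.
have E : mu_ball s.+1 = (mu_ball s + \sum_(x in layer s.+1) mu x)%N.
  rewrite -(addn1 s) mu_ballD; congr (_ + _)%N; apply: eq_bigl => y; rewrite inE; lia.
by have := card_layerS (ltn0Sn s) sK; have := IH (ltnW sK); rewrite E; lia.
Qed.

(* A descending path from [w] without branch vertices would extend to a strict ear of length [q + 1]. *)
Lemma branch_below r w : dist w = r.+1 -> (r.+1 + q < K)%N ->
  exists y, [/\ (r < dist y <= r + q)%N, (0 < mu y)%N & iter (dist y - r.+1) par y = w].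
Proof.
move=> dw rK.
have H j : (j <= q)%N ->
  (exists y, [/\ (r < dist y <= r + j)%N, (0 < mu y)%N & iter (dist y - r.+1) par y = w]) \/
  (exists u, [/\ dist u = (r.+1 + j)%N, iter j par u = w & forall i, (0 < i <= j)%N -> mu (iter i par u) = 0%N]).
  elim: j => [|j IH] jq.
    by right; exists w; rewrite addn0; split=> // i; lia.
  have [[y [dy my yw]]|[u [du uw um]]] := IH (ltnW jq); first by left; exists y; split=> //; lia.
  case: (posnP (mu u)) => mu0; last first.
    by left; exists u; split=> //; [lia|rewrite du addKn].
  have D : (0 < dist u < K)%N by rewrite du; lia.
  have hu := par_adj D.
  have [y [yp huy]] : exists y, y != par u /\ h u y.
    have := cardsD1 (par u) [set y | h u y]; rewrite inE hu -/(deg u).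
    have := deg2 hu; case: (set_0Vmem ([set y | h u y] :\ par u)) => [->|[y]].
      by rewrite cards0; lia.
    by rewrite !inE => /andP[? ?] _ _; exists y.
  have [py dy] : par y = u /\ dist y = (dist u).+1 by apply: nbr_child => //; rewrite du; lia.
  right; exists y; rewrite dy du; split; first by rewrite addnS.
    by rewrite iterSr py.
  by case=> // -[|i] ij; rewrite iterSr py //; apply: um; lia.
case: (H q (leqnn q)) => // -[u [du uw um]]; exfalso.
have D : (0 < dist u < K)%N by rewrite du; lia.
have E := dist_par D; have hp := par_adj D; rewrite sh in hp.
have [i iq] := branch_on_chain hp ltac:(lia) E ltac:(lia).
by rewrite -iterSr um //; lia.
Qed.

(** Each vertex of layer [r + 1] has a branch vertex among its descendants within the annulus, and
    different vertices have different ones. So the annulus has charge at least [#|layer r.+1|]. *)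
Lemma mu_ball_double r : (r.+1 + q < K)%N -> (2 * mu_ball r + 2 <= mu_ball (r + q))%N.
Proof.
move=> rK; rewrite mu_ballD.
have le1 := @card_layer_ball r ltac:(lia).
pose A := [set y | (r < dist y <= r + q)%N && (0 < mu y)%N].
have S : layer r.+1 \subset [set iter (dist y - r.+1) par y | y in A].
  apply/subsetP => w; rewrite inE => /eqP dw.
  have [y [dy my yw]] := branch_below dw rK.
  by apply/imsetP; exists y; rewrite ?yw // inE dy.
have le2 := leq_trans (subset_leq_card S) (leq_imset_card _ _).
have le3 : (#|A| <= \sum_(x | r < dist x <= r + q) mu x)%N.
  rewrite -sum1_card big_mkcond [leqRHS]big_mkcond /=; apply: leq_sum => y _.
  by rewrite /A inE; case: (r < dist y <= r + q)%N => //=; case: (mu y).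
by have := leq_trans le2 le3; lia.
Qed.

Lemma mu_ball_exp j : (0 < mu v)%N -> (0 < q)%N -> ((j * q).+1 < K)%N -> (3 * 2 ^ j <= mu_ball (j * q) + 2)%N.
Proof.
move=> mv q0; elim: j => [|j IH] jK.
  have -> : mu_ball (0 * q) = mu v.
    by rewrite mul0n /mu_ball (big_pred1 v) // => x; rewrite leqn0 dist0 Xv inE.
  by rewrite expn0; lia.
have := @mu_ball_double (j * q) ltac:(nia); have := IH ltac:(nia).
by rewrite expnS (_ : j.+1 * q = j * q + q)%N; [lia | rewrite mulSn addnC].
Qed.

End Growth.

End Forest.

(** * Dense shallow minors *)

Section DenseMinor.
Variables (T : finType) (h : rel T).
Hypotheses (sh : symmetric h) (ih : irreflexive h).

Lemma muS_setID (A B : {set T}) : muS h A = (muS h (A :&: B) + muS h (A :\: B))%N.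
Proof. exact: big_setID. Qed.

Lemma muS_mono (A B : {set T}) : A \subset B -> (muS h A <= muS h B)%N.
Proof. by move=> /setIidPr E; rewrite (muS_setID B A) E leq_addr. Qed.

Lemma sparse_dominating_set r N : (0 < N)%N ->
  (forall z, 0 < mu h z -> N <= muS h (nbhd h [set z] r))%N ->
  exists X : {set T}, [/\ forall x, x \in X -> (0 < mu h x)%N,
    (4 * muS h (~: nbhd h X r) <= muS h setT)%N & (N * #|X| <= 4 * muS h setT)%N].
Proof.
move=> N0 big.
pose P (X : {set T}) := X \subset [set x | (0 < mu h x)%N].
pose pot (X : {set T}) := (4 * muS h (~: nbhd h X r) + N * #|X|)%N.
have P0 : P set0 by apply: sub0set.
case: (@arg_minnP _ set0 P pot P0) => X PX Xmin.
(* Adding [v] cannot lower the potential, so the charge it newly covers is at most [N / 4]. *)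
have opt v : (0 < mu h v)%N -> (4 * muS h (nbhd h [set v] r :&: ~: nbhd h X r) <= N)%N.
  move=> mv; have PvX : P (v |: X) by rewrite /P subUset sub1set inE mv.
  have := Xmin _ PvX; rewrite /pot nbhdU1 setCU [in X in (X <= _)%N -> _](muS_setID _ (nbhd h [set v] r)).
  rewrite (setIC (~: nbhd h [set v] r)) -setDE (setIC (~: nbhd h X r) (nbhd _ [set v] r)) cardsU1.
  case: (v \notin X); rewrite /= ?add0n ?add1n; nia.
(* Pairs of a vertex [v] and an uncovered [z] within distance [r], weighted by both charges, are
   counted from either end. *)
have L : (\sum_v mu h v * muS h (nbhd h [set v] r :&: ~: nbhd h X r) =
          \sum_(z in ~: nbhd h X r) mu h z * muS h (nbhd h [set z] r))%N.
  under eq_bigr => v _ do rewrite /muS big_distrr.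
  under [RHS]eq_bigr => z _ do rewrite /muS big_distrr.
  rewrite (exchange_big_dep (fun z => z \in ~: nbhd h X r)) /=; last by move=> v z _; rewrite inE => /andP[].
  apply: eq_bigr => z zb; apply: eq_big => [v|v _]; last by rewrite mulnC.
  by rewrite inE zb andbT nbhd1_sym.
have H1 : (4 * \sum_v mu h v * muS h (nbhd h [set v] r :&: ~: nbhd h X r) <= N * muS h setT)%N.
  rewrite /muS !big_distrr /= [leqRHS](eq_bigl predT); last by move=> x; rewrite inE.
  apply: leq_sum => v _; case: (posnP (mu h v)) => [->|/opt]; rewrite /muS; nia.
have H2 : (N * muS h (~: nbhd h X r) <= \sum_(z in ~: nbhd h X r) mu h z * muS h (nbhd h [set z] r))%N.
  rewrite /muS big_distrr /=; apply: leq_sum => z _.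
  case: (posnP (mu h z)) => [->|/big]; rewrite /muS; nia.
exists X; split.
- by move=> x /(subsetP PX); rewrite inE.
- by rewrite L in H1; rewrite -(leq_pmul2l N0); nia.
- have := Xmin _ P0; rewrite /pot cards0 muln0 addn0 => le.
  apply: (@leq_trans (4 * muS h (~: nbhd h set0 r))%N); first by lia.
  by rewrite leq_mul2l muS_mono ?subsetT ?orbT.
Qed.

Variables (S : {set T}) (q g : nat).
Hypotheses (hS : forall x y, h x y -> x \in S) (Sdeg : forall x, x \in S -> (2 <= deg h x)%N).
Hypothesis girth : forall c, is_cycle h c -> (g < size c)%N.
Variable e : rel T.
Hypothesis he : subrel h e.

(** With [K = 1] each cell is a single vertex, so the minor is the core itself, and its minimum
    degree is at least 2. *)
Lemma trivial_minor : S != set0 -> (2 <= g)%N ->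
  exists (U : finType) (f : rel U),
    [/\ sgraph f, (0 < #|U|)%N, shallow_minor e f 0 & (#|U| <= nedges f)%N].
Proof.
move=> /set0Pn[x0 x0S] g2; exists (centers S), (@cell_adj _ h S 1).
have cS : covered h S 1 = S by apply/setP => x; rewrite inE ltnS leqn0 dist0.
have ltg x y : x \in covered h S 1 -> y \in covered h S 1 -> (dist h S 1 x + dist h S 1 y < g)%N.
  by rewrite !inE; lia.
split.
- exact: cell_adj_sgraph.
- by apply/card_gt0P; exists (exist _ x0 x0S).
- exact: (@shallow_minor_cells _ _ sh S 1 _ e 0).
- have c1 := card_cross_darts sh ih (isT : (0 < 1)%N) girth ltg.
  have c2 := @card_cell_adj _ _ sh ih S 1 isT _ girth 0 g2 isT.
  have c3 : out_darts h S 1 = set0.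
    apply/setP => -[x y]; rewrite /out_darts cS !inE /=; case hxy: (h x y) => //=.
    by rewrite (@hS y x) ?andbF // sh.
  rewrite c3 cards0 cS addn0 in c1; have {}c1 := leq_trans (c1 Sdeg) c2.
  by rewrite /nedges card_sig leq_divRL // mulnC; apply: leq_trans c1; rewrite leq_addl.
Qed.

Hypothesis q0 : (0 < q)%N.
Hypothesis short_ears : forall u z s, uniq (u :: rcons s z) -> path h u (rcons s z) ->
  (forall v, v \in s -> deg h v = 2%N) -> (size s < q)%N.

Let deg2 x y : h x y -> (2 <= deg h x)%N.
Proof. by move/hS/Sdeg. Qed.

Lemma mu_ball_nbhd X K r : (0 < K)%N -> (r < K)%N -> mu_ball h X K r = muS h (nbhd h X r).
Proof. by move=> K0 rK; apply: eq_bigl => x; rewrite dist_le_nbhd. Qed.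

(** Doubling from radius 0 already forces charge at least 2 within distance [q] of any vertex of the
    core. *)
Lemma muS_gt0 : S != set0 -> (2 * q + 3 <= g)%N -> (0 < muS h setT)%N.
Proof.
move=> /set0Pn[v vS] gq.
have := @mu_ball_double _ _ sh ih [set v] q.+2 isT _ girth _ deg2 short_ears v erefl (Sdeg vS).
move=> /(_ _ 0%N) H; have := H ltac:(lia) ltac:(lia); rewrite add0n !(@mu_ball_nbhd _ q.+2) ?ltnS // => le.
by apply: leq_trans (muS_mono (subsetT (nbhd h [set v] q))); lia.
Qed.

Theorem dense_shallow_minor D : S != set0 -> (2 * q + 3 <= g)%N -> (4 * (D.+1 * q) + 2 <= g)%N ->
  exists (U : finType) (f : rel U),
    [/\ sgraph f, (0 < #|U|)%N, shallow_minor e f (2 * (D.+1 * q)) & (3 * 2 ^ D * #|U| <= 16 * nedges f)%N].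
Proof.
move=> S0 gq gD; pose R := (D.+1 * q)%N; pose r := (D * q)%N.
have RE : R = (r + q)%N by rewrite /R mulSn addnC.
have mu0 := muS_gt0 S0 gq.
have e2 : (0 < 2 ^ D)%N by rewrite expn_gt0.
pose N := (3 * 2 ^ D - 2)%N.
have N0 : (0 < N)%N by rewrite /N; lia.
have K0 : (0 < R.+1)%N by [].
have nS x y : h x y -> y \in S by rewrite sh; apply: hS.
have mS x : (0 < mu h x)%N -> x \in S.
  rewrite /mu => mx; have /card_gt0P[y] : (0 < deg h x)%N by lia.
  by rewrite inE; apply: hS.
have [z mz|X [Xmu Xdom Xcard]] := @sparse_dominating_set r N N0.
  have := @mu_ball_exp _ _ sh ih [set z] R.+1 K0 _ girth _ deg2 short_ears z erefl (Sdeg (mS _ mz)).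
  move=> /(_ ltac:(rewrite /R; lia) D mz q0 ltac:(rewrite /R; lia)).
  by rewrite mu_ball_nbhd // -/r /N; lia.
have XS : X \subset S by apply/subsetP => x /Xmu/mS.
(* For empty [X] all charge is uncovered, although at most a quarter of the positive total may
   be. *)
have X0 : (0 < #|X|)%N.
  rewrite lt0n cards_eq0; apply/eqP => X0; move: Xdom.
  have -> : nbhd h X r = set0 by apply/setP => x; rewrite inE X0; apply/nbhdP => -[v]; rewrite inE.
  by rewrite setC0; lia.
have cS : {in covered h X R.+1, forall x, (2 <= deg h x)%N}.
  move=> x; rewrite inE ltnS dist_le_nbhd // => /nbhdP[v vX [s [ps <- _]]]; apply: Sdeg.
  case/lastP: s ps => [|s y] /=; first by move=> _; apply: (subsetP XS).
  by rewrite rcons_path last_rcons => /andP[_]; apply: nS.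
have ltg x y : x \in covered h X R.+1 -> y \in covered h X R.+1 ->
    (dist h X R.+1 x + dist h X R.+1 y < g)%N.
  by rewrite !inE /R; lia.
have c1 := card_cross_darts sh ih K0 girth ltg cS.
have c2 := @card_cell_adj _ _ sh ih X R.+1 K0 _ girth R gD (leqnn _).
have c3 := @card_out_darts _ _ sh X R.+1 K0 q deg2 short_ears r q0 (f_equal succn RE).
exists (centers X), (@cell_adj _ h X R.+1); split.
- exact: cell_adj_sgraph.
- by rewrite card_sig.
- exact: (@shallow_minor_cells _ _ sh X R.+1 _ e R).
have E1 : (muS h (covered h X R.+1) + muS h (~: covered h X R.+1) = muS h setT)%N.
  by rewrite (muS_setID setT (covered h X R.+1)) setTI setTD.
(* The annulus, which pays for the out darts, and the part beyond [R] together carry at most a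
   quarter of the total charge. *)
have E2 : (\sum_(y | r < dist h X R.+1 y < R.+1) mu h y + muS h (~: covered h X R.+1) = muS h (~: nbhd h X r))%N.
  rewrite (muS_setID (~: nbhd h X r) (covered h X R.+1)).
  have rR : (r < R.+1)%N by rewrite RE; lia.
  congr (_ + _)%N; apply: eq_bigl => x; rewrite !inE -(@dist_le_nbhd _ h X R.+1) //; lia.
have c4 : (muS h (covered h X R.+1) + 2 * #|X| <=
   #|[set p : centers X * centers X | cell_adj h R.+1 p.1 p.2]| + #|out_darts h X R.+1|)%N.
  by apply: leq_trans c1 _; rewrite leq_add2r.
have cU : #|{: centers X}| = #|X| by rewrite card_sig; apply: eq_card.
rewrite /nedges cU; move: #|[set p | _]| #|out_darts _ _ _| c3 c4 => F O c3 c4.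
rewrite (_ : (3 * 2 ^ D = N + 2)%N); last by rewrite /N; lia.
have := divn_eq F 2; have := ltn_pmod F (isT : (0 < 2)%N).
(* With total charge [M], the losses are at most [M / 2], so [F] is at least [M / 2 + 2 * #|X|],
   while [N * #|X| <= 4 * M]. The surplus in [#|X|] absorbs the rounding in [F %/ 2]. *)
have F2 : (N * #|X| + 16 * #|X| <= 8 * F)%N by lia.
rewrite mulnDl; lia.
Qed.

End DenseMinor.
(** * The Lambert function *)

Section LambertBounds.
Local Open Scope R_scope.

Lemma LambertWm1_spec t : 0 < t -> t <= / exp 1 ->
  LambertWm1 (- t) <= -1 /\ LambertWm1 (- t) * exp (LambertWm1 (- t)) = - t.
Proof.
move=> t0 te; apply: (epsilon_spec (inhabits 0) (fun z => z <= -1 /\ z * exp z = - t)).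
(* The intermediate value theorem is applied to [- z]. At [M] the bound [exp M >= (M / 2) ^ 2] gives
   [M * exp (- M) <= 4 / M <= t]. *)
pose f z := z * exp (- z) - t; pose M := 1 + 4 / t.
have t4 : 0 < 4 / t by apply: Rdiv_lt_0_compat; lra.
have Mge : 1 <= M by rewrite /M; lra.
have cf : continuity f by rewrite /f; reg.
have f1 : 0 <= f 1 by rewrite /f Rmult_1_l exp_Ropp; lra.
have fM : f M <= 0.
  have E : M / 2 * (M / 2) <= exp M.
    have -> : exp M = exp (M / 2) * exp (M / 2) by rewrite -exp_plus; f_equal; lra.
    have := exp_ineq1_le (M / 2); nra.
  have Mt : M * t = t + 4 by rewrite /M; field; lra.
  suff : M * exp (- M) <= t by rewrite /f; lra.
  rewrite exp_Ropp; apply: (Rmult_le_reg_r (exp M)); first exact: exp_pos.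
  rewrite Rmult_assoc Rinv_l; last by have := exp_pos M; lra.
  by nra.
have [z [[z1 zM] fz]] := IVT_cor f 1 M cf Mge ltac:(nra).
exists (- z); split; first lra.
by move: fz; rewrite /f; lra.
Qed.

(** With [d = w' - w], the bound [exp d > 1 + d] gives [w * exp d > w + w * d >= w'], as
    [w >= 1]. *)
Lemma mul_exp_opp_decr w w' : 1 <= w -> w < w' -> w' * exp (- w') < w * exp (- w).
Proof.
move=> w1 ww'.
have E : exp (- w) = exp (- w') * exp (w' - w) by rewrite -exp_plus; f_equal; lra.
have e0 := exp_pos (- w').
have I := exp_ineq1 (w' - w) ltac:(lra).
rewrite E; have : w' < w * exp (w' - w) by nra.
by nra.
Qed.

Lemma gp_arg_gt0 a b p : 0 < a -> 0 < b -> (0 < p)%N -> 0 < gp_arg a b p.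
Proof.
move=> a0 b0 p0; have P : 0 < INR p by apply: lt_0_INR; lia.
have A0 : 0 < Rpower (24 * sqrt 2 * a) (/ b) by apply: exp_pos.
have ln2 := ln_lt_2; apply: Rdiv_lt_0_compat; first lra.
by repeat apply: Rmult_lt_0_compat.
Qed.

Lemma Rpower_lt_exp a b p y : 0 < a -> 0 < b -> (0 < p)%N -> gp_arg a b p <= / exp 1 ->
  - (2 * b / ln 2) * LambertWm1 (- gp_arg a b p) < y ->
  a * Rpower (y * INR p / 2) b < Rpower 2 (y / 2) / (24 * sqrt 2).
Proof.
move=> a0 b0 p0 ge; have g0 := gp_arg_gt0 a0 b0 p0.
have [] := LambertWm1_spec g0 ge; set W := LambertWm1 _ => W1 WE yW.
have P : 0 < INR p by apply: lt_0_INR; lia.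
have l2 := ln_lt_2; have s2 : 0 < sqrt 2 by apply: sqrt_lt_R0; lra.
have c0 : 0 < 2 * b / ln 2 by apply: Rdiv_lt_0_compat; lra.
have y0 : 0 < y by nra.
(* Chosen so that [exp (b * w')] is [2 ^ (y / 2)]; the hypothesis on [y] says that [w'] exceeds
   [- W]. *)
pose w' := y * ln 2 / (2 * b).
have ww' : - W < w'.
  apply: (Rmult_lt_reg_r (2 * b / ln 2)) => //.
  have -> : w' * (2 * b / ln 2) = y by rewrite /w'; field; lra.
  lra.
have H := mul_exp_opp_decr (w := - W) ltac:(lra) ww'.
move: WE H; rewrite Ropp_involutive => WE; have -> : - W * exp W = gp_arg a b p by lra.
rewrite /gp_arg; set A := Rpower _ (/ b) => H.
have A0 : 0 < A by apply: exp_pos.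
have H1 : y * INR p / 2 * A < exp w'.
  move: H; rewrite exp_Ropp => H.
  have e0 := exp_pos w'.
  have H2 : w' < ln 2 / (A * b * INR p) * exp w'.
    have : w' * / exp w' * exp w' < ln 2 / (A * b * INR p) * exp w' by apply: Rmult_lt_compat_r.
    by rewrite Rmult_assoc Rinv_l; lra.
  have c1 : 0 < A * b * INR p / ln 2.
    by apply: Rdiv_lt_0_compat; [repeat apply: Rmult_lt_0_compat|lra].
  have := Rmult_lt_compat_r _ _ _ c1 H2.
  have -> : w' * (A * b * INR p / ln 2) = y * INR p / 2 * A by rewrite /w'; field; lra.
  have -> : ln 2 / (A * b * INR p) * exp w' * (A * b * INR p / ln 2) = exp w' by field; repeat split; lra.
  by [].
have yp0 : 0 < y * INR p / 2 by nra.
have H3 := Rlt_Rpower_l _ _ _ b0 (conj (Rmult_lt_0_compat _ _ yp0 A0) H1).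
move: H3; rewrite -Rpower_mult_distr // /A Rpower_mult Rinv_l; last lra.
have a24 : 0 < 24 * sqrt 2 * a by nra.
rewrite Rpower_1 // /Rpower ln_exp.
have -> : b * w' = y / 2 * ln 2 by rewrite /w'; field; lra.
move=> H3; apply: (Rmult_lt_reg_r (24 * sqrt 2)); first lra.
have -> : exp (y / 2 * ln 2) / (24 * sqrt 2) * (24 * sqrt 2) = exp (y / 2 * ln 2) by field; lra.
lra.
Qed.

End LambertBounds.

(** * Asymptotics of [gp] *)

Section GpAsymptotics.
Local Open Scope R_scope.

Lemma ln_le_half w : 0 < w -> ln w <= w / 2.
Proof.
move=> w0; have L : ln (w / 2) <= w / 2 - 1.
  by have := exp_ineq1_le (ln (w / 2)); rewrite exp_ln; lra.
have l2 : ln 2 <= 1 by have := exp_ineq1_le (ln 2); rewrite exp_ln; lra.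
by move: L; rewrite ln_div //; lra.
Qed.

(* With [w = - W_{-1}(-t)], the defining equation reads [w - ln w = - ln t]. *)
Lemma LambertWm1_bounds t : 0 < t -> t <= / exp 1 ->
  - ln t <= - LambertWm1 (- t) <= - ln t + ln (2 * - ln t).
Proof.
move=> t0 te; have [] := LambertWm1_spec t0 te.
set w := - LambertWm1 (- t); have -> : LambertWm1 (- t) = - w by rewrite /w; lra.
move=> w1 we.
have E : ln t = ln w - w.
  by rewrite (_ : t = w * exp (- w)) ?ln_mult ?ln_exp; try apply: exp_pos; lra.
have lw : 0 <= ln w by rewrite -ln_1; apply: ln_le; lra.
have half := @ln_le_half w ltac:(lra).
split; first lra.
by have : ln w <= ln (2 * - ln t); [apply: ln_le; lra | lra].
Qed.

Lemma is_lim_seq_ln_INR : is_lim_seq (fun p => ln (INR p)) p_infty.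
Proof. by apply: is_lim_comp_seq is_lim_ln_p _ is_lim_seq_INR; exists 0%N. Qed.

Lemma is_lim_seq_inv_ln_INR : is_lim_seq (fun p => / ln (INR p)) 0.
Proof. by have := is_lim_seq_inv _ _ is_lim_seq_ln_INR; apply. Qed.

Lemma is_lim_seq_ln_div (u : nat -> R) : is_lim_seq u p_infty ->
  is_lim_seq (fun p => ln (u p) / u p) 0.
Proof. by move=> up; apply: is_lim_comp_seq is_lim_div_ln_p _ up; exists 0%N. Qed.

Lemma is_lim_seq_ln_gp_arg a b : 0 < a -> 0 < b ->
  is_lim_seq (fun p => - ln (gp_arg a b p)) p_infty /\
  is_lim_seq (fun p => - ln (gp_arg a b p) / ln (INR p)) 1.
Proof.
move=> a0 b0; pose A := Rpower (24 * sqrt 2 * a) (/ b) * b; pose t0 := ln 2 / A.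
have A0 : 0 < A by apply: Rmult_lt_0_compat => //; apply: exp_pos.
have l2 := ln_lt_2.
have t00 : 0 < t0 by apply: Rdiv_lt_0_compat; lra.
have E p : (1 <= p)%N -> - ln (gp_arg a b p) = ln (INR p) + - ln t0.
  move=> p1; have P : 0 < INR p by apply: lt_0_INR; lia.
  have -> : gp_arg a b p = t0 / INR p by rewrite /gp_arg /t0 -/A; field; lra.
  by rewrite ln_div //; lra.
split.
  apply: (is_lim_seq_ext_loc (fun p => ln (INR p) + - ln t0)).
    by exists 1%N => p p1; rewrite E //; lia.
  by apply: (is_lim_seq_plus _ _ p_infty (- ln t0)); [exact: is_lim_seq_ln_INR|exact: is_lim_seq_const|].
apply: (is_lim_seq_ext_loc (fun p => 1 + - ln t0 * / ln (INR p))).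
  exists 3%N => p p3; rewrite E; last lia.
  have : 0 < ln (INR p) by rewrite -ln_1; apply: ln_increasing; [lra|apply: lt_1_INR; lia].
  by move=> ?; field; lra.
have -> : Rbar.Finite 1 = Rbar.Finite (1 + - ln t0 * 0) by f_equal; lra.
apply: is_lim_seq_plus'; first exact: is_lim_seq_const.
by apply: is_lim_seq_mult'; [exact: is_lim_seq_const|exact: is_lim_seq_inv_ln_INR].
Qed.

Lemma Lambert_over_ln a b : 0 < a -> 0 < b ->
  is_lim_seq (fun p => - LambertWm1 (- gp_arg a b p) / ln (INR p)) 1.
Proof.
move=> a0 b0; have [sinf slim] := is_lim_seq_ln_gp_arg a0 b0.
pose s p := - ln (gp_arg a b p).
have ev1 : eventually (fun p => 1 <= s p).
  by have := proj1 (is_lim_seq_p_infty_Reals _) sinf 1 => -[N HN]; exists N => p /HN; rewrite /s; lra.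
apply: (is_lim_seq_le_le_loc (fun p => s p / ln (INR p)) _
          (fun p => s p / ln (INR p) * (1 + 2 * (ln (2 * s p) / (2 * s p))))).
- case: ev1 => N HN; exists (N + 3)%N => p pN.
  have s1 : 1 <= s p by apply: HN; lia.
  have l0 : 0 < ln (INR p) by rewrite -ln_1; apply: ln_increasing; [lra|apply: lt_1_INR; lia].
  have g0 := @gp_arg_gt0 a b p a0 b0 ltac:(lia).
  (* [1 <= s p] is the logarithmic form of the range condition for [LambertWm1]. *)
  have ge : gp_arg a b p <= / exp 1.
    rewrite -exp_Ropp -[gp_arg a b p]exp_ln //; rewrite /s in s1.
    have [/exp_increasing|->] : ln (gp_arg a b p) < Ropp 1 \/ ln (gp_arg a b p) = Ropp 1 by lra.
      exact: Rlt_le.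
    exact: Rle_refl.
  have [lo hi] := LambertWm1_bounds g0 ge; rewrite -/(s p) in lo hi.
  split; first by apply: Rmult_le_compat_r => //; left; apply: Rinv_0_lt_compat.
  have -> : s p / ln (INR p) * (1 + 2 * (ln (2 * s p) / (2 * s p))) = (s p + ln (2 * s p)) / ln (INR p).
    by field; lra.
  by apply: Rmult_le_compat_r => //; left; apply: Rinv_0_lt_compat.
- exact: slim.
- have -> : Rbar.Finite 1 = Rbar.Finite (1 * (1 + 2 * 0)) by f_equal; lra.
  apply: is_lim_seq_mult'; first exact: slim.
  apply: is_lim_seq_plus'; first exact: is_lim_seq_const.
  apply: is_lim_seq_mult'; first exact: is_lim_seq_const.
  apply: is_lim_seq_ln_div.
  have -> : p_infty = Rbar_mult 2 p_infty.
    by rewrite /Rbar_mult /Rbar_mult' /=; case: Rle_dec => [H|]; [case: Rle_lt_or_eq_dec => //|]; lra.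
  exact: is_lim_seq_scal_l.
Qed.

Lemma gp_equiv a b : 0 < a -> 0 < b ->
  is_lim_seq (fun p : nat => gp a b p / (4 * b * INR p * (ln (INR p) / ln 2))) 1.
Proof.
move=> a0 b0; pose c := 2 * b / ln 2; have l2 := ln_lt_2.
have c0 : 0 < c by apply: Rdiv_lt_0_compat; lra.
pose w p := - LambertWm1 (- gp_arg a b p).
have wlim : is_lim_seq (fun p => w p / ln (INR p)) 1 := Lambert_over_ln a0 b0.
have invp : is_lim_seq (fun p => / INR p) 0.
  by have := is_lim_seq_inv _ _ is_lim_seq_INR; apply.
have invl := is_lim_seq_inv_ln_INR.
have ev : eventually (fun p => 0 <= w p).
  have [N HN] := proj1 (is_lim_seq_Reals _ _) wlim 1 ltac:(lra).
  exists (N + 3)%N => p pN; have := HN p ltac:(lia); rewrite /R_dist => /Rabs_def2 [_ H].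
  have l0 : 0 < ln (INR p) by rewrite -ln_1; apply: ln_increasing; [lra|apply: lt_1_INR; lia].
  have -> : w p = w p / ln (INR p) * ln (INR p) by field; lra.
  by nra.
pose M p := Rmax 7 (2 * Rfloor (- (2 * b / ln 2) * LambertWm1 (- gp_arg a b p)) + 4).
have Mlim : is_lim_seq (fun p => M p / (2 * c * ln (INR p))) 1.
  apply: (is_lim_seq_le_le_loc (fun p => w p / ln (INR p)) _
            (fun p => w p / ln (INR p) + 7 / (2 * c) * / ln (INR p))).
  - case: ev => N HN; exists (N + 3)%N => p pN.
    have w0 : 0 <= w p by apply: HN; lia.
    have l0 : 0 < ln (INR p) by rewrite -ln_1; apply: ln_increasing; [lra|apply: lt_1_INR; lia].
    have E : - (2 * b / ln 2) * LambertWm1 (- gp_arg a b p) = c * w p by rewrite /c /w; lra.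
    have [f1 f2] := base_Int_part (c * w p).
    have cw : 0 <= c * w p by nra.
    (* The floor loses at most 1, which the summand 4 outweighs, so the floor and the maximum shift
       [2 * c * w p] by a bounded amount only. *)
    have lo : 2 * c * w p <= M p by rewrite /M E /Rfloor; apply: Rle_trans (Rmax_r _ _); lra.
    have hi : M p <= 2 * c * w p + 7 by rewrite /M E /Rfloor; apply: Rmax_lub; lra.
    have i0 : 0 < / (2 * c * ln (INR p)) by apply: Rinv_0_lt_compat; nra.
    have -> : w p / ln (INR p) = 2 * c * w p * / (2 * c * ln (INR p)) by field; lra.
    have -> : 2 * c * w p * / (2 * c * ln (INR p)) + 7 / (2 * c) * / ln (INR p)
              = (2 * c * w p + 7) * / (2 * c * ln (INR p)) by field; lra.
    by split; apply: Rmult_le_compat_r; lra.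
  - exact: wlim.
  - have -> : Rbar.Finite 1 = Rbar.Finite (1 + 7 / (2 * c) * 0) by f_equal; lra.
    by apply: is_lim_seq_plus' => //; apply: is_lim_seq_mult' => //; apply: is_lim_seq_const.
apply: (is_lim_seq_ext_loc (fun p => M p / (2 * c * ln (INR p)) * (1 + -1 * / INR p))).
  exists 3%N => p p3.
  have P : 0 < INR p by apply: lt_0_INR; lia.
  have l0 : 0 < ln (INR p) by rewrite -ln_1; apply: ln_increasing; [lra|apply: lt_1_INR; lia].
  by rewrite /gp -/(M p) /c; field; lra.
have -> : Rbar.Finite 1 = Rbar.Finite (1 * (1 + -1 * 0)) by f_equal; lra.
apply: is_lim_seq_mult' => //; apply: is_lim_seq_plus'; first exact: is_lim_seq_const.
by apply: is_lim_seq_mult' => //; apply: is_lim_seq_const.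
Qed.

End GpAsymptotics.

(** * Irreducible cores *)

(** Since [p >= 2], a deleted ear has an internal vertex, so each reduction strictly shrinks the set
    and reducing must stop. *)
Lemma irreducible_core (T : finType) (e : rel T) (p : nat) (S : {set T}) : (2 <= p)%N ->
  ~ p_reducible e p S -> exists S' : {set T}, S' != set0 /\ forall S'', ~ p_reduction e p S' S''.
Proof.
move=> p2; move: {2}#|S|.+1 (ltnSn #|S|) => n; elim: n S => // n IH S Sn nred.
case: (classic (exists S'', p_reduction e p S S'')) => [[S'' red]|irr]; last first.
  exists S; split; last by move=> S'' red; apply: irr; exists S''.
  by apply/eqP => S0; apply: nred; rewrite S0; apply: p_red_empty.
apply: (IH S''); last by move=> red''; apply: nred; apply: p_red_step red red''.
suff : S'' \proper S by move/proper_card; lia.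
case: red => [[x [xS _ ->]]|[x0 [xk [s [[_ /allP sS _ _] [_ ps ->]]]]]]; first exact: properD1.
case: s ps sS => [|v s] ps sS; first by move: ps => /=; lia.
apply/properP; split; first exact: subsetDl.
exists v; last by rewrite !inE eqxx.
by apply: sS; rewrite /= !inE eqxx orbT.
Qed.

Definition induced (T : finType) (e : rel T) (S : {set T}) : rel T :=
  fun x y => [&& e x y, x \in S & y \in S].

Lemma deg_induced (T : finType) (e : rel T) (S : {set T}) x : x \in S -> deg (induced e S) x = deg_in e S x.
Proof. by move=> xS; apply: eq_card => y; rewrite !inE /induced xS /= andbC. Qed.

Lemma induced_path_in (T : finType) (e : rel T) (S : {set T}) u s :
  path (induced e S) u s -> s != [::] -> {subset u :: s <= S}.
Proof.
case: s => // v s + _; elim: s u v => [|w s IH] u v /=.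
  by rewrite andbT => /and3P[_ uS vS] x; rewrite !inE => /orP[] /eqP->.
case/andP=> /and3P[_ uS _] /IH H x; rewrite inE => /orP[/eqP->//|]; exact: H.
Qed.

Lemma core_min_deg (T : finType) (e : rel T) (p : nat) (S : {set T}) x :
  (forall S', ~ p_reduction e p S S') -> x \in S -> (2 <= deg (induced e S) x)%N.
Proof.
move=> irr xS; rewrite deg_induced // leqNgt; apply/negP => d1.
by apply: (irr (S :\ x)); left; exists x; split.
Qed.

(** An ear with [q] internal vertices has length [q + 1], which is the reduction threshold. *)
Lemma core_short_ears (T : finType) (e : rel T) (q : nat) (S : {set T}) u z s :
  (forall S', ~ p_reduction e q.+1 S S') ->
  uniq (u :: rcons s z) -> path (induced e S) u (rcons s z) ->
  (forall v, v \in s -> deg (induced e S) v = 2%N) -> (size s < q)%N.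
Proof.
move=> irr us ps d2; rewrite ltnNge; apply/negP => qs.
have sub := induced_path_in ps (ltac:(by case: (s))).
apply: (irr (S :\: [set v in s])); right; exists u, z, s; split; split=> //.
- exact/allP.
- by apply: sub_path ps => x y /and3P[].
- by move: us; rewrite /= mem_rcons inE negb_or => /andP[/andP[]].
- move=> v vs; rewrite -(d2 _ vs) deg_induced //; apply: sub.
  by rewrite inE mem_rcons inE vs !orbT.
Qed.

Lemma INR_pow2 n : INR (2 ^ n)%N = Rpower 2 (INR n).
Proof.
rewrite Rpower_pow; last lra.
elim: n => // n IH; rewrite expnS; rewrite mult_INR IH /=; lra.
Qed.

Lemma INR_density (A B E : nat) : (3 * A * B <= 16 * E)%N -> (3 / 16 * INR A * INR B <= INR E)%R.
Proof.
move=> le; have := IZR_le (3 * Z.of_nat A * Z.of_nat B) (16 * Z.of_nat E) ltac:(lia).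
rewrite !mult_IZR -!INR_IZR_INZ; lra.
Qed.

(** * Degeneracy from large girth *)

Section Degenerate.
Local Open Scope R_scope.

Lemma Rpower_density_mono a b u v : 0 < a -> 0 < b -> 0 < u <= v -> a * Rpower u b <= a * Rpower v b.
Proof.
move=> a0 b0 uv; apply: Rmult_le_compat_l; first lra.
by apply: Rle_Rpower_l => //; lra.
Qed.

Lemma path_degenerate_of_girth (C : forall T : finType, rel T -> Prop) (a b : R) (p : nat) :
  0 < a -> 0 < b -> Exp_le C (fun k => a * Rpower ((INR k + 1) / 2) b) ->
  (2 <= p)%N -> gp_arg a b p <= / exp 1 ->
  forall (T : finType) (e : rel T), sgraph e -> C T e -> girth_gt e (gp a b p) -> p_path_degenerate e p.
Proof.
move=> a0 b0 HC p2 ge T e [se ie] Ce girth; apply: NNPP => nred.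
have [S [S0 irr]] := irreducible_core p2 nred.
case: p p2 ge girth nred irr => // q q1 ge girth _ irr.
pose h := induced e S.
have he : subrel h e by move=> x y /and3P[].
have sh : symmetric h by move=> x y; rewrite /h /induced se (andbC (x \in S)).
have ih : irreflexive h by move=> x; rewrite /h /induced ie.
have hS x y : h x y -> x \in S by case/and3P.
have Sdeg x : x \in S -> (2 <= deg h x)%N := core_min_deg irr.
have ears u z s := @core_short_ears T e q S u z s irr.
have [W1 _] := LambertWm1_spec (gp_arg_gt0 a0 b0 (ltac:(lia) : (0 < q.+1)%N)) ge.
set x := - (2 * b / ln 2) * LambertWm1 (- gp_arg a b q.+1).
have l2 := ln_lt_2.
have x0 : 0 < x.
  have c0 : 0 < 2 * b / ln 2 by apply: Rdiv_lt_0_compat; lra.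
  by rewrite /x; nra.
have [f1 f2] := base_Int_part x.
have z0 : (0 <= Int_part x)%Z.
  by have : (-1 < Int_part x)%Z; [apply: lt_IZR; lra | lia].
pose m := (Z.to_nat (Int_part x)).+1.
have mE : INR m = IZR (Int_part x) + 1 by rewrite /m S_INR INR_IZR_INZ Znat.Z2Nat.id.
have mx : x < INR m by lra.
(* Equals [(2 * floor x + 4) * (p - 1)] for [p = q + 1]. *)
pose g := ((2 * m + 2) * q)%N.
have gh c : is_cycle h c -> (g < size c)%N.
  case=> c3 uc cc; have ec : is_cycle e c by split=> //; apply: sub_cycle cc.
  have := girth c ec; rewrite /gp -/x => lt.
  apply/ltP; apply: INR_lt; apply: Rle_lt_trans lt.
  rewrite mult_INR plus_INR mult_INR (S_INR q) mE /Rfloor.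
  have -> : INR q + 1 - 1 = INR q by lra.
  by apply: Rmult_le_compat_r; [apply: pos_INR | apply: Rle_trans (Rmax_r _ _); rewrite /=; lra].
have bound := Rpower_lt_exp a0 b0 (ltac:(lia) : (0 < q.+1)%N) ge mx.
have qp : 1 <= INR q by apply: (le_INR 1); lia.
have m1 : 1 <= INR m by apply: (le_INR 1); lia.
have s2 : 1 <= sqrt 2 by rewrite -sqrt_1; apply: sqrt_le_1_alt; lra.
have ss : sqrt 2 * sqrt 2 = 2 by apply: sqrt_sqrt; lra.
(* A minor at depth [k / 2] with [k + 1 <= m * p] has density at most [a * (m * p / 2) ^ b], which
   [bound] controls. *)
have contra (U : finType) (f : rel U) k t : sgraph f -> (0 < #|U|)%N -> shallow_minor e f k ->
    t * INR #|U| <= INR (nedges f) -> INR k + 1 <= INR m * INR q.+1 ->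
    t < Rpower 2 (INR m / 2) / (24 * sqrt 2).
  move=> sf U0 sm tU km; have le := HC T e (conj se ie) Ce k U f sf U0 sm.
  have UR : 0 < INR #|U| by apply: lt_0_INR; lia.
  have tle : t <= INR (nedges f) / INR #|U|.
    apply: (Rmult_le_reg_r (INR #|U|)) => //.
    by rewrite /Rdiv Rmult_assoc Rinv_l; lra.
  apply: Rle_lt_trans bound; apply: Rle_trans tle _; apply: Rle_trans le _.
  by apply: Rpower_density_mono => //; have := pos_INR k; lra.
(* For [m = 1] there is no admissible [D]; the core has density at least 1, against the bound
   [1 / 24]. *)
case: (ltnP m 2) => m2.
  have gg : (2 <= g)%N by rewrite /g; nia.
  have [U [f [sf U0 sm den]]] := trivial_minor sh ih hS Sdeg gh he S0 gg.
  have den' : 1 * INR #|U| <= INR (nedges f) by rewrite Rmult_1_l; apply: le_INR; apply/leP.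
  have qR : INR q.+1 = INR q + 1 by apply: S_INR.
  have km : INR 0 + 1 <= INR m * INR q.+1 by rewrite qR (_ : INR 0 = 0) //; nra.
  have := contra U f 0%N 1 sf U0 sm den' km.
  have -> : m = 1%N by lia.
  have -> : INR 1 / 2 = / 2 by rewrite /=; lra.
  rewrite Rpower_sqrt; last lra.
  have -> : sqrt 2 / (24 * sqrt 2) = / 24 by field; lra.
  by lra.
pose D := (m./2).-1.
have DE : m./2 = D.+1 by rewrite /D; lia.
have g1 : (2 * q + 3 <= g)%N by rewrite /g; nia.
have g2 : (4 * (D.+1 * q) + 2 <= g)%N by rewrite /g -DE; nia.
have [U [f [sf U0 sm den]]] := dense_shallow_minor sh ih hS Sdeg gh he (ltac:(lia) : (0 < q)%N) ears S0 g1 g2.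
have den' : 3 / 16 * Rpower 2 (INR D) * INR #|U| <= INR (nedges f).
  by rewrite -INR_pow2; apply: INR_density.
have km : INR (2 * (D.+1 * q))%N + 1 <= INR m * INR q.+1.
  by rewrite -mult_INR -S_INR; apply: le_INR; apply/leP; rewrite -DE; nia.
have := contra U f _ _ sf U0 sm den' km.
apply: Rle_not_lt.
(* From [m <= 2 * D + 3] the upper bound is at most [2 * sqrt 2 * 2 ^ D / (24 * sqrt 2) = 2 ^ D /
   12], below the density [3 * 2 ^ D / 16]. *)
have mD : INR m / 2 <= INR D + 1 + / 2.
  have := le_INR _ _ (ltac:(lia) : (m <= 2 * D + 3)%coq_nat).
  by rewrite plus_INR mult_INR /=; lra.
have le : Rpower 2 (INR m / 2) <= Rpower 2 (INR D + 1 + / 2) by apply: Rle_Rpower; lra.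
move: le; rewrite !Rpower_plus Rpower_1 ?Rpower_sqrt; try lra.
move=> le; apply: (Rmult_le_reg_r (24 * sqrt 2)); first lra.
have -> : Rpower 2 (INR m / 2) / (24 * sqrt 2) * (24 * sqrt 2) = Rpower 2 (INR m / 2) by field; lra.
have P0 : 0 < Rpower 2 (INR D) by apply: exp_pos.
by nra.
Qed.

End Degenerate.

Theorem mainTheorem2 (C : forall T : finType, rel T -> Prop) (a b : R) :
  (0 < a)%R -> (0 < b)%R ->
  Exp_le C (fun k => a * Rpower ((INR k + 1) / 2) b)%R ->
  (forall p : nat, (2 <= p)%N -> (gp_arg a b p <= / exp 1)%R ->
     forall (T : finType) (e : rel T), sgraph e -> C T e ->
       girth_gt e (gp a b p) -> p_path_degenerate e p)
  /\
  is_lim_seq (fun p : nat => gp a b p / (4 * b * INR p * (ln (INR p) / ln 2)))%R 1%R.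
Proof.
move=> a0 b0 HC; split; last exact: gp_equiv.
by move=> p p2 ge T e; apply: path_degenerate_of_girth.
Qed.
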